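(* Let $m$ and $n$ be positive integers with $1<m<n$. Then there exists a noncatenary local integral domain of dimension $n$ with a saturated chain of prime ideals of length $m$ from $(0)$ to the maximal ideal.
   Context: All rings are commutative with identity. A local ring is a Noetherian ring with a unique maximal ideal. The length of a chain of prime ideals $P_0\subsetneq\dots\subsetneq P_k$ is $k$. A ring is catenary if for all pairs of prime ideals $P\subsetneq Q$, all saturated chains of prime ideals between $P$ and $Q$ have the same length; otherwise it is noncatenary. *)

(* Defs.v *)
From mathcomp Require Import all_boot all_algebra.
From mathcomp Require Import boolp classical_sets.

Set Implicit Arguments.
Unset Strict Implicit.
Unset Printing Implicit Defensive.

Import GRing.Theory.
Local Open Scope ring_scope.
Local Open Scope classical_set_scope.

(* The ideals of ring_quotient are boolean predicates and are proper by
   definition; here an ideal is an arbitrary set, and may be the unit ideal. *)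
Definition ideal (R : comNzRingType) (I : set R) : Prop :=
  [/\ I 0,
      forall x y, I x -> I y -> I (x + y)
    & forall a x, I x -> I (a * x)].

Definition prime_ideal (R : comNzRingType) (P : set R) : Prop :=
  [/\ ideal P, ~ P 1 & forall x y, P (x * y) -> P x \/ P y].

Definition maximal_ideal (R : comNzRingType) (M : set R) : Prop :=
  [/\ ideal M, ~ M 1
    & forall I : set R, ideal I -> ~ I 1 -> M `<=` I -> I = M].

Definition generated_ideal (R : comNzRingType) (k : nat) (g : 'I_k -> R) :
    set R :=
  [set x | exists c : 'I_k -> R, x = \sum_(i < k) c i * g i].

Definition noetherian (R : comNzRingType) : Prop :=
  forall I : set R, ideal I ->
    exists (k : nat) (g : 'I_k -> R), I = generated_ideal g.

Definition local_ring (R : comNzRingType) : Prop :=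
  noetherian R /\ exists! M : set R, maximal_ideal M.

(* The chain C 0 < ... < C k, indexed by 'I_k.+1, has length k. *)
Definition prime_chain (R : comNzRingType) (k : nat) (C : 'I_k.+1 -> set R) :
    Prop :=
  (forall i, prime_ideal (C i)) /\
  (forall i j : 'I_k.+1, (i < j)%N -> C i `<` C j).

Definition saturated_chain (R : comNzRingType) (k : nat)
    (C : 'I_k.+1 -> set R) : Prop :=
  prime_chain C /\
  (forall i j : 'I_k.+1, j = i.+1 :> nat ->
    ~ exists Q : set R, [/\ prime_ideal Q, C i `<` Q & Q `<` C j]).

Definition saturated_chain_between (R : comNzRingType) (P Q : set R)
    (k : nat) (C : 'I_k.+1 -> set R) : Prop :=
  [/\ saturated_chain C, C ord0 = P & C ord_max = Q].

Definition catenary (R : comNzRingType) : Prop :=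
  forall P Q : set R, prime_ideal P -> prime_ideal Q -> P `<` Q ->
  forall (k l : nat) (C : 'I_k.+1 -> set R) (D : 'I_l.+1 -> set R),
    saturated_chain_between P Q C -> saturated_chain_between P Q D -> k = l.

Definition has_krull_dim (R : comNzRingType) (n : nat) : Prop :=
  (exists C : 'I_n.+1 -> set R, prime_chain C) /\
  (forall (k : nat) (C : 'I_k.+1 -> set R), prime_chain C -> (k <= n)%N).

(* Main.v *)
(** Let T be the polynomial ring over the rationals in countably many variables.
    Since T is isomorphic to T[X], it surjects onto itself with kernel a prime
    of any prescribed height: let [phi1] kill the first n variables, and let
    [phi2] send the first variable to 1 and kill the m - 1 following ones. The
    kernels are comaximal, because the first variable goes to 0 under [phi1] and
    to 1 under [phi2]. The equalizer B of [phi1] and [phi2] glues the two kernels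
    into the single prime J = ker phi1 /\ ker phi2, and R is B localized at J.

    Localizing T at the nonzero polynomials in all but the first n variables
    gives a polynomial ring in n variables over a field. Hence the localization
    of T at the complement of the two kernels is Noetherian, and so is R because
    T = B + B e for the first variable e. Below J, the primes of B are the traces
    of primes of T, so the coordinate chains of lengths n and m remain saturated
    in R. Finally dim R <= n, because any n + 1 elements of T are algebraically
    dependent over the polynomials in all but the first n variables. *)

From HB Require Import structures.
Require Import Defs.
From mathcomp Require Import all_boot all_algebra.
From mathcomp Require Import boolp classical_sets functions.
From mathcomp Require Import ring zify.

Set Implicit Arguments.
Unset Strict Implicit.
Unset Printing Implicit Defensive.

Import GRing.Theory Num.Theory.
Local Open Scope ring_scope.
Local Open Scope classical_set_scope.

(** * Subrings without zero divisors as integral domains *)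

Section IntegralSubring.
Variables (A : comNzRingType) (D : {pred A}).
Hypothesis D_subring : subring_closed D.
Hypothesis D_integral :
  forall x y, x \in D -> y \in D -> x * y = 0 -> x = 0 \/ y = 0.

Record integral_subring : Type :=
  IntegralSubring { isr_val : A; isr_valP : isr_val \in D }.

HB.instance Definition _ := [isSub for isr_val].
HB.instance Definition _ := [Choice of integral_subring by <:].
HB.instance Definition _ :=
  GRing.SubChoice_isSubComNzRing.Build A D integral_subring D_subring.

(** [A] carries no chosen inverse, and an inverse in [A] might leave [D], so invertibility inside
    the subring is decided classically. *)
Let isr_unit : {pred integral_subring} := fun x => `[< exists y, y * x = 1 >].
Let isr_inv (x : integral_subring) : integral_subring :=
  if pselect (exists y, y * x = 1) is left h then projT1 (cid h) else x.

Let isr_mulVx : {in isr_unit, left_inverse 1 isr_inv *%R}.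
Proof.
move=> x /asboolP hx; rewrite /isr_inv; case: pselect => // h.
exact: projT2 (cid h).
Qed.

Let isr_unitPl (x y : integral_subring) : y * x = 1 -> isr_unit x.
Proof. by move=> h; apply/asboolP; exists y. Qed.

Let isr_inv_out : {in [predC isr_unit], isr_inv =1 id}.
Proof.
move=> x /asboolPn hx; rewrite /isr_inv; case: pselect => // h.
Qed.

HB.instance Definition _ := GRing.ComNzRing_hasMulInverse.Build
  integral_subring isr_mulVx isr_unitPl isr_inv_out.

Let isr_integral (x y : integral_subring) :
  x * y = 0 -> (x == 0) || (y == 0).
Proof.
move=> /(congr1 val); rewrite rmorphM rmorph0 => xy0.
have [h|h] := D_integral (valP x) (valP y) xy0; apply/orP; [left|right];
  by apply/eqP/val_inj; rewrite rmorph0.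
Qed.

HB.instance Definition _ :=
  GRing.ComUnitRing_isIntegral.Build integral_subring isr_integral.

Lemma integral_subring_idomain :
  exists (R : idomainType) (i : {rmorphism R -> A}),
    injective i /\ forall x, x \in D <-> exists y, i y = x.
Proof.
exists integral_subring, (val : {rmorphism integral_subring -> A}).
split; first exact: val_inj.
by move=> x; split=> [hx|[y <-]]; [exists (IntegralSubring hx) | exact: valP].
Qed.

End IntegralSubring.

(** * Polynomial functions in countably many variables *)

Section PolynomialFunctions.

Local Notation F := (GRing.ComNzRing.clone ((nat -> nat) -> rat) _).

Let vcons (t : nat) (w : nat -> nat) : nat -> nat :=
  fun i => if i is j.+1 then w j else t.

Let shiftf (f : F) : F := fun v => f (v \o S).

Let shiftf_zmod : zmod_morphism shiftf.
Proof. by move=> f g; apply/funext. Qed.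
Let shiftf_monoid : monoid_morphism shiftf.
Proof. by split=> [|f g]; apply/funext. Qed.
HB.instance Definition _ := GRing.isZmodMorphism.Build F F shiftf shiftf_zmod.
HB.instance Definition _ := GRing.isMonoidMorphism.Build F F shiftf shiftf_monoid.

Let evalf (w : nat -> nat) (f : F) : rat := f w.
Let evalf_zmod w : zmod_morphism (evalf w).
Proof. by []. Qed.
Let evalf_monoid w : monoid_morphism (evalf w).
Proof. by []. Qed.
HB.instance Definition _ w :=
  GRing.isZmodMorphism.Build F rat (evalf w) (evalf_zmod w).
HB.instance Definition _ w :=
  GRing.isMonoidMorphism.Build F rat (evalf w) (evalf_monoid w).

Let head : F := fun v => (v 0%N)%:R.

(** This becomes the isomorphism from T[X] to T: the indeterminate turns into the first variable,
    and the variables of the coefficients move up by one. *)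
Let consf (p : {poly F}) : F := (map_poly shiftf p).[head].

Let consf0 : consf 0 = 0.
Proof. by rewrite /consf rmorph0 horner0. Qed.
Let consfC c : consf c%:P = shiftf c.
Proof. by rewrite /consf map_polyC hornerC. Qed.
Let consfB p q : consf (p - q) = consf p - consf q.
Proof. by rewrite /consf rmorphB hornerD hornerN. Qed.
Let consfM p q : consf (p * q) = consf p * consf q.
Proof. by rewrite /consf rmorphM hornerM. Qed.

Let consfE p t w : consf p (vcons t w) = (map_poly (evalf w) p).[t%:R].
Proof.
rewrite -[LHS]/(evalf (vcons t w) (consf p)) /consf -horner_map -map_poly_comp.
by congr (_.[_]).
Qed.

(* A rational polynomial vanishing at every natural number is zero. *)
Let consf_eq0 p : consf p = 0 -> p = 0.
Proof.
move=> p0; apply/polyP => i; rewrite coef0; apply/funext => w.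
suff: map_poly (evalf w) p = 0 by move/(congr1 (coefp i)); rewrite /= coef_map coef0.
set q := map_poly _ _.
apply: (@roots_geq_poly_eq0 _ q [seq t%:R | t <- iota 0 (size q)]).
- apply/allP => _ /mapP [t _ ->]; rewrite /root -consfE p0; exact/eqP.
- rewrite map_inj_uniq ?iota_uniq // => a b /eqP; rewrite eqr_nat; exact/eqP.
- by rewrite size_map size_iota.
Qed.

(** These are the functions polynomial in the first [N] coordinates. The recursion through [consf]
    makes every element of level [N.+1] a value of [consf] by construction. *)
Fixpoint polyfun_rec (N : nat) (f : F) : Prop :=
  if N is N'.+1 then
    exists2 p : {poly F}, (forall i, polyfun_rec N' p`_i) & f = consf p
  else exists c : rat, f = fun=> c.

Let polyfun_rec0 N : polyfun_rec N 0.
Proof.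
elim: N => [|N IH]; first by exists 0.
by exists 0; rewrite ?consf0 // => i; rewrite coef0.
Qed.

Let polyfun_recB N f g :
  polyfun_rec N f -> polyfun_rec N g -> polyfun_rec N (f - g).
Proof.
elim: N f g => [|N IH] f g /= => [[c ->] [d ->]|[p hp ->] [q hq ->]].
  by exists (c - d).
by exists (p - q); rewrite ?consfB // => i; rewrite coefB; apply: IH.
Qed.

Let polyfun_recD N f g :
  polyfun_rec N f -> polyfun_rec N g -> polyfun_rec N (f + g).
Proof.
move=> hf hg; rewrite -[g]opprK; apply: polyfun_recB => //.
by rewrite -sub0r; apply: polyfun_recB.
Qed.

Let polyfun_recM N f g :
  polyfun_rec N f -> polyfun_rec N g -> polyfun_rec N (f * g).
Proof.
elim: N f g => [|N IH] f g /= => [[c ->] [d ->]|[p hp ->] [q hq ->]].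
  by exists (c * d).
exists (p * q); rewrite ?consfM // => i; rewrite coefM.
by elim/big_ind: _ => // [x y hx hy|j _]; [exact: polyfun_recD | exact: IH].
Qed.

Let polyfun_recS N f : polyfun_rec N f -> polyfun_rec N.+1 f.
Proof.
elim: N f => [f [c ->]|N IH f [p hp ->]].
  pose g : F := fun=> c; exists g%:P; last by rewrite consfC.
  by move=> i; rewrite coefC; case: eqP => _; [exists c | exact: (polyfun_rec0 0)].
by exists p => // i; apply: IH; apply: hp.
Qed.

Let polyfun_rec_le M N f : (M <= N)%N -> polyfun_rec M f -> polyfun_rec N f.
Proof.
by move=> /subnK <-; elim: (N - M)%N => // k IH /IH; apply: polyfun_recS.
Qed.

Let polyfun : {pred F} := fun f => `[< exists N, polyfun_rec N f >].

Let polyfun2 f g : f \in polyfun -> g \in polyfun ->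
  exists N, polyfun_rec N f /\ polyfun_rec N g.
Proof.
move=> /asboolP [M hM] /asboolP [N hN]; exists (maxn M N).
by split; [apply: polyfun_rec_le hM; apply: leq_maxl
          | apply: polyfun_rec_le hN; apply: leq_maxr].
Qed.

Let polyfun_subring : subring_closed polyfun.
Proof.
split; first by apply/asboolP; exists 0%N, 1.
  move=> f g hf hg; have [N [fN gN]] := polyfun2 hf hg.
  by apply/asboolP; exists N; apply: polyfun_recB.
move=> f g hf hg; have [N [fN gN]] := polyfun2 hf hg.
by apply/asboolP; exists N; apply: polyfun_recM.
Qed.

(** The leading coefficients in the first variable multiply to zero, so by induction on the number
    of variables one of them vanishes, and its polynomial with it. *)
Let polyfun_integral f g :
  f \in polyfun -> g \in polyfun -> f * g = 0 -> f = 0 \/ g = 0.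
Proof.
move=> hf hg; have [N [{hf}hf {hg}hg]] := polyfun2 hf hg.
elim: N f g hf hg => [|N IH] f g /= => [[c ->] [d ->]|[p hp ->] [q hq ->]].
  move=> /(congr1 (fun h : F => h (fun=> 0%N))) /eqP.
  by rewrite mulf_eq0 => /orP [] /eqP /= ->; [left|right].
rewrite -consfM => /consf_eq0 pq0.
have : lead_coef p * lead_coef q = 0.
  by rewrite mul_lead_coef pq0 coef0.
move=> /(IH _ _ (hp _) (hq _)) [] /eqP; rewrite lead_coef_eq0 => /eqP ->;
  rewrite consf0; by [left|right].
Qed.

(* Witnessed by the polynomials over [rat] in countably many variables. *)
Lemma exists_idomain_iso_poly : exists (T : idomainType)
    (tau : {rmorphism T -> {poly T}}) (theta : {rmorphism {poly T} -> T}),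
  cancel tau theta /\ cancel theta tau.
Proof.
have [T [i [i_inj iP]]] :=
  integral_subring_idomain polyfun_subring polyfun_integral.
have cons_ex p : exists y, i y = consf (map_poly i p).
  apply/iP/asboolP.
  (* The finitely many coefficients are put on one common level. *)
  suff [N hN] : exists N, forall j, polyfun_rec N (i p`_j).
    by exists N.+1, (map_poly i p) => // j; rewrite coef_map; apply: hN.
  elim/poly_ind: p => [|p c [N hN]].
    by exists 0%N => j; rewrite coef0 rmorph0; apply: (polyfun_rec0 0).
  have /asboolP [M hM] : i c \in polyfun by apply/iP; exists c.
  exists (maxn M N) => j; rewrite coefD coefMX coefC.
  case: j => [|j] /=.
    by rewrite add0r; apply: polyfun_rec_le hM; apply: leq_maxl.
  by rewrite addr0; apply: polyfun_rec_le (hN j); apply: leq_maxr.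
have [theta thetaE] := choice cons_ex.
have theta_zmod : zmod_morphism theta.
  by move=> p q; apply: i_inj; rewrite rmorphB !thetaE rmorphB consfB.
have theta_monoid : monoid_morphism theta.
  split=> [|p q]; apply: i_inj; last by rewrite rmorphM !thetaE rmorphM consfM.
  by rewrite thetaE !rmorph1 consfC rmorph1.
pose thetaM : {rmorphism {poly T} -> T} := HB.pack theta
  (GRing.isZmodMorphism.Build _ _ theta theta_zmod)
  (GRing.isMonoidMorphism.Build _ _ theta theta_monoid).
have theta_inj : injective theta.
  move=> p q /eqP; rewrite -subr_eq0 -theta_zmod => /eqP /(congr1 i).
  rewrite thetaE rmorph0 => /consf_eq0 pq0; apply/polyP => j; apply: i_inj.
  have := congr1 (fun r : {poly F} => r`_j) pq0.
  rewrite coef_map coef0 coefB raddfB.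
  by move/eqP; rewrite subr_eq0 => /eqP.
have theta_surj f : exists p, theta p = f.
  have /asboolP [N] : i f \in polyfun by apply/iP; exists f.
  (* Raising the level by one puts even a constant in the form [consf p]. *)
  move=> /polyfun_recS [p hp ip].
  have hc j : exists c, i c = p`_j by apply/iP/asboolP; exists N; apply: hp.
  have [c cE] := choice hc.
  exists (\poly_(j < size p) c j); apply: i_inj; rewrite thetaE ip; congr consf.
  apply/polyP => j; rewrite coef_map coef_poly.
  case: ltnP => [_|hj]; first exact: cE.
  by rewrite raddf0 nth_default.
have [tau tauK] := choice theta_surj.
have thetaK : cancel theta tau by move=> p; apply: theta_inj; rewrite tauK.
have tau_zmod : zmod_morphism tau.
  by move=> f g; apply: theta_inj; rewrite theta_zmod !tauK.
have tau_monoid : monoid_morphism tau.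
  have [t1 tM] := theta_monoid.
  by split=> [|f g]; apply: theta_inj; rewrite ?t1 ?tM !tauK.
pose tauM : {rmorphism T -> {poly T}} := HB.pack tau
  (GRing.isZmodMorphism.Build _ _ tau tau_zmod)
  (GRing.isMonoidMorphism.Build _ _ tau tau_monoid).
by exists T, tauM, thetaM.
Qed.
End PolynomialFunctions.

(** * Noetherianity relative to a multiplicative set *)

Section RelativeNoetherian.
Variable R : comNzRingType.

Lemma idealN (I : set R) x : ideal I -> I x -> I (- x).
Proof. by case=> _ _ hM Ix; rewrite -mulN1r; apply: hM. Qed.

Lemma idealB (I : set R) x y : ideal I -> I x -> I y -> I (x - y).
Proof. by move=> hI Ix Iy; case: (hI) => _ hD _; apply: hD => //; apply: idealN. Qed.

Definition mul_closed (S : set R) : Prop :=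
  S 1 /\ forall a b, S a -> S b -> S (a * b).

Definition saturated (S H : set R) : Prop :=
  forall s f, S s -> H (s * f) -> H f.

(* Equivalent to the localization of R at S being Noetherian. *)
Definition noetherian_at (S : set R) : Prop :=
  forall I : set R, ideal I ->
    exists G : seq R, (forall g, g \in G -> I g) /\
      forall H : set R, ideal H -> saturated S H ->
        (forall g, g \in G -> H g) -> I `<=` H.

End RelativeNoetherian.

(** The localization is the fraction field, where any nonzero element generates the unit ideal. *)
Lemma noetherian_at_nonzero (R : idomainType) :
  noetherian_at [set x : R | x != 0].
Proof.
move=> I hI; have [[g [Ig g0]]|hI0] := pselect (exists g, I g /\ g != 0).
  exists [:: g]; split=> [h|H hH satH HG f If]; first by rewrite inE => /eqP ->.
  apply: (satH g) => //; rewrite mulrC; case: hH => _ _ hM; apply: hM.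
  by apply: HG; rewrite inE.
exists [::]; split=> // H [H0 _ _] _ _ f If.
have [->//|f0] := eqVneq f 0.
by case: hI0; exists f.
Qed.

(** * Hilbert's basis theorem relative to a multiplicative set *)

Section HilbertBasis.
Variables (R : comNzRingType) (S : set R).
Hypotheses (S_mul : mul_closed S) (S_noeth : noetherian_at S).

Let SP : set {poly R} := [set s%:P | s in S].

Let top_coefs (I : set {poly R}) (d : nat) : set R :=
  [set c | exists f, [/\ I f, (size f <= d.+1)%N & f`_d = c]].

Let top_coefs_ideal I d : ideal I -> ideal (top_coefs I d).
Proof.
case=> I0 ID IM; split; first by exists 0; rewrite size_poly0 coef0.
- move=> _ _ [f [If sf <-]] [g [Ig sg <-]]; exists (f + g).
  rewrite coefD; split=> //; first exact: ID.
  by rewrite (leq_trans (size_polyD _ _)) // geq_max sf.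
move=> a _ [f [If sf <-]]; exists (a%:P * f); rewrite coefCM; split=> //.
  exact: IM.
by rewrite mul_polyC (leq_trans (size_scale_leq _ _)).
Qed.

Let top_coefs_mono I d e : ideal I -> (d <= e)%N ->
  top_coefs I d `<=` top_coefs I e.
Proof.
case=> I0 ID IM le_de _ [f [If sf <-]]; exists ('X^(e - d) * f); split.
- exact: IM.
- apply/leq_sizeP => j hj; rewrite coefXnM; case: ltnP => // _.
  apply: (leq_sizeP _ _ sf); lia.
by rewrite coefXnM ltnNge leq_subr /= subKn.
Qed.

(** Intersecting with [I] lets the cancelling polynomial be subtracted without leaving [I]; the
    multiplier [s] makes the ideal saturated. *)
Let sat_coefs (I H : set {poly R}) (d : nat) : set R :=
  [set c | exists s, S s /\ top_coefs (I `&` H) d (s * c)].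

Let ideal_setI (I H : set {poly R}) : ideal I -> ideal H -> ideal (I `&` H).
Proof.
move=> [I0 ID IM] [H0 HD HM]; split=> //.
  by move=> x y [Ix Hx] [Iy Hy]; split; [apply: ID | apply: HD].
by move=> a x [Ix Hx]; split; [apply: IM | apply: HM].
Qed.

Let sat_coefs_ideal I H d : ideal I -> ideal H -> ideal (sat_coefs I H d).
Proof.
move=> hI hH; have [S1 SM] := S_mul.
have [T0 TD TM] := top_coefs_ideal d (ideal_setI hI hH).
split; first by exists 1; rewrite mulr0.
  move=> x y [s [Ss hs]] [t [St ht]]; exists (s * t); split; first exact: SM.
  have -> : s * t * (x + y) = t * (s * x) + s * (t * y) by ring.
  by apply: TD; apply: TM.
move=> a x [s [Ss hs]]; exists s; split=> //.
by rewrite mulrCA; apply: TM.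
Qed.

Let sat_coefs_sat I H d : saturated S (sat_coefs I H d).
Proof.
move=> s f Ss [t [St h]]; exists (t * s); split; last by rewrite -mulrA.
by have [_] := S_mul; apply.
Qed.

(** It suffices to lift the generators of [L] to polynomials of [I], because [sat_coefs I H d] is a
    saturated ideal. *)
Let top_gens I d (L : set R) : ideal I -> ideal L -> L `<=` top_coefs I d ->
  exists G : seq {poly R}, (forall g, g \in G -> I g) /\
    forall H, ideal H -> saturated SP H -> (forall g, g \in G -> H g) ->
      L `<=` sat_coefs I H d.
Proof.
move=> hI hL subL; have [G [GL hG]] := S_noeth hL.
have lift_ex c : exists f : {poly R}, c \in G ->
    [/\ I f, (size f <= d.+1)%N & f`_d = c].
  have [cG|_] := boolP (c \in G); last by exists 0.
  by have [f hf] := subL c (GL c cG); exists f.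
have [l lP] := choice lift_ex.
exists [seq l c | c <- G]; split.
  by move=> _ /mapP [c cG ->]; case: (lP c cG).
move=> H hH satH HG; apply: hG; first exact: sat_coefs_ideal.
  exact: sat_coefs_sat.
move=> c cG; exists 1; split; first by case: S_mul.
have [If sf fd] := lP c cG; exists (l c); split=> //; last by rewrite mul1r.
by split=> //; apply: HG; apply/mapP; exists c.
Qed.

(* [e] may exceed the degree [d] of the generators because they can be
   multiplied by powers of 'X. *)
Let descent (I H : set {poly R}) d e (f : {poly R}) :
  ideal I -> ideal H -> saturated SP H -> (d <= e)%N ->
  I f -> (size f <= e.+1)%N -> sat_coefs I H d f`_e ->
  (forall g, I g -> (size g <= e)%N -> H g) -> H f.
Proof.
move=> hI hH satH le_de If sf [s [Ss hs]] IH.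
have [h [[Ih Hh] sh he]] := top_coefs_mono (ideal_setI hI hH) le_de hs.
apply: (satH s%:P); first by exists s.
rewrite -[_ * f](subrK h); have [_ HD _] := hH; apply: HD => //; apply: IH.
  by apply: idealB => //; case: hI => _ _; apply.
apply/leq_sizeP => j; rewrite leq_eqVlt => /orP [/eqP <-|ej].
  by rewrite coefB coefCM he subrr.
rewrite coefB coefCM (leq_sizeP _ _ sf) // (leq_sizeP _ _ sh) //.
by rewrite mulr0 subr0.
Qed.

Let low_gens (I : set {poly R}) d : ideal I -> exists G : seq {poly R},
  (forall g, g \in G -> I g) /\
  forall H, ideal H -> saturated SP H -> (forall g, g \in G -> H g) ->
    forall f, I f -> (size f <= d)%N -> H f.
Proof.
move=> hI; elim: d => [|d [G [GI hG]]].
  exists [::]; split=> // H [H0 _ _] _ _ f _.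
  by rewrite leqn0 size_poly_eq0 => /eqP ->.
have [G' [GI' hG']] := top_gens hI (top_coefs_ideal d hI) (@subset_refl _ _).
exists (G ++ G'); split.
  by move=> g; rewrite mem_cat => /orP [/GI|/GI'].
move=> H hH satH HG f If sf.
have HG1 g : g \in G -> H g by move=> h; apply: HG; rewrite mem_cat h.
have HG2 g : g \in G' -> H g by move=> h; apply: HG; rewrite mem_cat h orbT.
apply: (@descent I H d d) => //; last exact: hG.
by apply: hG' => //; exists f.
Qed.

(** The leading coefficients of all degrees form an ideal whose finitely many generators occur by
    some degree [D]. Below [D] each degree has its own generators; from [D] on, those of degree [D]
    cancel the leading term, up to a multiplier in [S]. *)
Lemma hilbert_basis : noetherian_at SP.
Proof.
move=> I hI.
pose L : set R := [set c | exists d, top_coefs I d c].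
have hL : ideal L.
  split; first by exists 0%N; case: (top_coefs_ideal 0 hI).
    move=> x y [d hx] [e hy]; exists (maxn d e).
    have [_ TD _] := top_coefs_ideal (maxn d e) hI; apply: TD.
      by apply: top_coefs_mono hx => //; apply: leq_maxl.
    by apply: top_coefs_mono hy => //; apply: leq_maxr.
  move=> a x [d hx]; exists d.
  by have [_ _ TM] := top_coefs_ideal d hI; apply: TM.
have [GL [GLL hGL]] := S_noeth hL.
have [D hD] : exists D, forall c, c \in GL -> top_coefs I D c.
  elim: GL GLL {hGL} => [|c G IH] hc; first by exists 0%N.
  have [D hD] : exists D, forall c, c \in G -> top_coefs I D c.
    by apply: IH => g gG; apply: hc; rewrite inE gG orbT.
  have [e he] := hc c (mem_head _ _).
  exists (maxn D e) => c'; rewrite inE => /orP [/eqP ->|/hD].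
    by apply: top_coefs_mono he => //; apply: leq_maxr.
  by apply: top_coefs_mono => //; apply: leq_maxl.
have [G1 [GI1 hG1]] := low_gens D hI.
have [G2 [GI2 hG2]] := top_gens hI (top_coefs_ideal D hI) (@subset_refl _ _).
exists (G1 ++ G2); split.
  by move=> g; rewrite mem_cat => /orP [/GI1|/GI2].
move=> H hH satH HG f.
have HG1 g : g \in G1 -> H g by move=> h; apply: HG; rewrite mem_cat h.
have HG2 g : g \in G2 -> H g by move=> h; apply: HG; rewrite mem_cat h orbT.
have Lsub : L `<=` sat_coefs I H D.
  apply: hGL; [exact: sat_coefs_ideal | exact: sat_coefs_sat |].
  by move=> c /hD; apply: hG2.
move: {2}(size f) (leqnn (size f)) => e; elim: e f => [|e IH] f sf If.
  by have [H0 _ _] := hH; move: sf; rewrite leqn0 size_poly_eq0 => /eqP ->.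
have [le_De|lt_eD] := leqP D e.
  apply: (@descent I H D e) => //; last by move=> g Ig sg; apply: IH.
  by apply: Lsub; exists e, f.
by apply: (hG1 H) => //; apply: leq_trans sf lt_eD.
Qed.

End HilbertBasis.

(** * Shifts and evaluations of the variables, and the primes they define *)

Lemma prime_idealX (R : comNzRingType) (Q : set R) x k :
  prime_ideal Q -> Q (x ^+ k) -> Q x.
Proof.
move=> [_ Q1 QM]; elim: k => [|k IH]; first by rewrite expr0.
by rewrite exprS => /QM [].
Qed.

Lemma rmorph_ker_prime (R : comNzRingType) (K : idomainType)
    (f : {rmorphism R -> K}) : prime_ideal [set x | f x = 0].
Proof.
split=> [||x y /=]; last 1 first.
- by rewrite rmorphM => /eqP; rewrite mulf_eq0 => /orP [] /eqP; [left|right].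
- split=> /= [|x y fx fy|a x fx]; first by rewrite rmorph0.
    by rewrite rmorphD fx fy addr0.
  by rewrite rmorphM fx mulr0.
by rewrite /= rmorph1 => /eqP; rewrite oner_eq0.
Qed.

Section ShiftRing.
Variables (T : idomainType) (tau : {rmorphism T -> {poly T}}).
Variable theta : {rmorphism {poly T} -> T}.
Hypotheses (tauK : cancel tau theta) (thetaK : cancel theta tau).

(** With [tau] splitting off the first variable, this renames every variable to the one [k] places
    later. *)
Fixpoint shift_iter (k : nat) : {rmorphism T -> T} :=
  if k is k'.+1 then GRing.RMorphism.clone T T (theta \o (polyC \o shift_iter k')) _
  else GRing.RMorphism.clone T T idfun _.

Definition head_eval (c : T) : {rmorphism T -> T} :=
  GRing.RMorphism.clone T T (horner_eval c \o tau) _.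

(** For [k > 0] and [c] equal to 0 or 1, the first variable goes to [c], the next [k - 1] go to
    zero, and the others are renumbered from the start. *)
Fixpoint eval_iter (c : T) (k : nat) : {rmorphism T -> T} :=
  if k is k'.+1 then GRing.RMorphism.clone T T (eval_iter 0 k' \o head_eval c) _
  else GRing.RMorphism.clone T T idfun _.

Lemma head_evalE c f : head_eval c f = (tau f).[c].
Proof. by []. Qed.

Lemma shift_iterS k f : shift_iter k.+1 f = theta (shift_iter k f)%:P.
Proof. by []. Qed.

Lemma shift_iterD j k f : shift_iter (j + k) f = shift_iter j (shift_iter k f).
Proof. by elim: j => //= j ->. Qed.

Lemma tau_eq0 f : (tau f == 0) = (f == 0).
Proof. by rewrite -(rmorph0 tau) (inj_eq (can_inj tauK)). Qed.

Lemma theta_eq0 p : (theta p == 0) = (p == 0).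
Proof. by rewrite -(rmorph0 theta) (inj_eq (can_inj thetaK)). Qed.

Lemma shift_iter_eq0 k f : (shift_iter k f == 0) = (f == 0).
Proof. by elim: k => //= k IH; rewrite theta_eq0 polyC_eq0. Qed.

Lemma head_eval_theta c p : head_eval c (theta p) = p.[c].
Proof. by rewrite head_evalE thetaK. Qed.

Lemma eval_shift_iter c k f : eval_iter c k (shift_iter k f) = f.
Proof.
elim: k c => // k IH c.
rewrite -[LHS]/(eval_iter 0 k (head_eval c (theta (shift_iter k f)%:P))).
by rewrite head_eval_theta hornerC IH.
Qed.

Lemma eval_shift_iter_neq0 c k n f : (k <= n)%N -> f != 0 ->
  eval_iter c k (shift_iter n f) != 0.
Proof.
by move=> /subnKC <- f0; rewrite shift_iterD eval_shift_iter shift_iter_eq0.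
Qed.

(** The recursion evaluates the first variable first; isolating the last one instead is what
    compares consecutive kernels. *)
Lemma eval_iterS c k f :
  eval_iter c k.+1 f = head_eval (if k is 0 then c else 0) (eval_iter c k f).
Proof.
have eval0S j g : eval_iter 0 j.+1 g = head_eval 0 (eval_iter 0 j g).
  by elim: j g => // j IH g; rewrite -[LHS]/(eval_iter 0 j.+1 (head_eval 0 g)) IH.
by case: k => // k; rewrite -[LHS]/(eval_iter 0 k.+1 (head_eval c f)) eval0S.
Qed.

Lemma eval_iter_ker_mono c j k f : (j <= k)%N ->
  eval_iter c j f = 0 -> eval_iter c k f = 0.
Proof.
move=> /subnK <-; elim: (k - j)%N => // i IH /IH.
by rewrite addSn eval_iterS => ->; rewrite rmorph0.
Qed.

Lemma eval_iter_head (c : T) k : eval_iter c k.+1 (theta 'X) = eval_iter 0 k c.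
Proof. by rewrite -[LHS]/(eval_iter 0 k (tau (theta 'X)).[c]) thetaK hornerX. Qed.

Lemma eval_iter_ker_strict c k :
  exists w, eval_iter c k w != 0 /\ eval_iter c k.+1 w = 0.
Proof.
set a : T := if k is 0 then c else 0.
exists (shift_iter k (theta ('X - a%:P))); rewrite eval_iterS eval_shift_iter.
by rewrite theta_eq0 polyXsubC_eq0 head_eval_theta hornerXsubC subrr.
Qed.

(** Modulo the smaller kernel, the larger one is generated by [w], a lift of ['X - a%:P]. Divide the
    highest power of it out of an element of [Q] outside the smaller kernel: the cofactor does not
    vanish at [a], hence is not in [Q], so the prime [Q] contains [w]. *)
Lemma eval_iter_ker_saturated c k (Q : set T) : prime_ideal Q ->
  [set f | eval_iter c k f = 0] `<=` Q ->
  Q `<=` [set f | eval_iter c k.+1 f = 0] ->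
  (exists2 f, Q f & eval_iter c k f != 0) ->
  [set f | eval_iter c k.+1 f = 0] `<=` Q.
Proof.
move=> hQ kerQ Qker [f Qf f0]; set a : T := if k is 0 then c else 0.
have [[Q0 QD QM] Q1 QP] := hQ; pose w := shift_iter k (theta ('X - a%:P)).
have Qw : Q w.
  have [r [q qa tq]] := multiplicity_XsubC (tau (eval_iter c k f)) a.
  rewrite tau_eq0 f0 /= in qa.
  pose g := shift_iter k (theta q).
  have : Q (g * w ^+ r).
    have -> : g * w ^+ r = f - (f - g * w ^+ r) by ring.
    apply: idealB => //; apply: kerQ => /=.
    rewrite rmorphB rmorphM rmorphXn !eval_shift_iter -rmorphXn -rmorphM -tq.
    by rewrite tauK subrr.
  case/QP => [/Qker|]; last exact: prime_idealX.
  rewrite /mkset eval_iterS eval_shift_iter head_eval_theta => qa0.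
  by case/negP: qa; apply/eqP.
move=> h; rewrite /mkset eval_iterS head_evalE => /eqP /factor_theorem [q tq].
rewrite -[h](subrK (shift_iter k (theta q) * w)); apply: QD; last exact: QM.
apply: kerQ; rewrite /mkset rmorphB rmorphM !eval_shift_iter -rmorphM -tq.
by rewrite tauK subrr.
Qed.

Definition shift_nonzero (k : nat) : set T :=
  [set shift_iter k c | c in [set c | c != 0]].

Lemma shift_nonzero_mul k : mul_closed (shift_nonzero k).
Proof.
split; first by exists 1; rewrite /= ?oner_neq0 ?rmorph1.
move=> _ _ [a a0 <-] [b b0 <-]; exists (a * b); last by rewrite rmorphM.
by rewrite /= mulf_neq0.
Qed.

(** The localization is a polynomial ring in [k] variables over a field; each passage through
    [theta] adds one variable by [hilbert_basis]. *)
Lemma shift_noetherian k : noetherian_at (shift_nonzero k).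
Proof.
elim: k => [|k IH].
  have -> : shift_nonzero 0 = [set x : T | x != 0].
    by apply/seteqP; split=> [x [y y0 <-]//|x x0]; exists x.
  exact: noetherian_at_nonzero.
move=> I [I0 ID IM].
have [|G [GI hG]] := hilbert_basis (shift_nonzero_mul k) IH (I := [set p | I (theta p)]).
  split=> /= [|x y|a x]; first by rewrite rmorph0.
    by rewrite rmorphD; apply: ID.
  by rewrite rmorphM; apply: IM.
exists [seq theta g | g <- G]; split; first by move=> _ /mapP [g /GI ? ->].
move=> H [H0 HD HM] satH HG f If; rewrite -[f]tauK.
apply: (hG [set p | H (theta p)]); rewrite /= ?tauK //.
- split=> /= [|x y|a x]; first by rewrite rmorph0.
    by rewrite rmorphD; apply: HD.
  by rewrite rmorphM; apply: HM.
- move=> _ p [_ [s s0 <-] <-] /=; rewrite rmorphM; apply: satH.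
  by exists s.
by move=> g gG; apply: HG; apply: map_f.
Qed.

End ShiftRing.

(** * Linear dependence over a domain *)

Lemma fraction_numden (R : idomainType) (x : {fraction R}) :
  exists nd : R * R, nd.2 != 0 /\ x * tofrac nd.2 = tofrac nd.1.
Proof.
elim/quotW: x => r; exists (frac r); split; first exact: denom_ratioP.
rewrite -[LHS]/(FracField.mul _ _) !piE.
apply/eqmodP; rewrite /= FracField.equivfE.
rewrite /FracField.mulf !numden_Ratio ?(oner_eq0, mulf_neq0, denom_ratioP) //.
by rewrite !mulr1 mulrC.
Qed.

(** A matrix with more rows than columns has a nonzero left kernel vector over the fraction field;
    the product of its denominators brings it into [R]. *)
Lemma linear_dependence (R : idomainType) (I J : finType) (d : I -> J -> R) :
  (#|J| < #|I|)%N ->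
  exists c : I -> R, (exists i, c i != 0) /\ forall j, \sum_i c i * d i j = 0.
Proof.
move=> ltJI.
pose M := \matrix_(i < #|I|, j < #|J|) tofrac (d (enum_val i) (enum_val j)).
have /rowV0Pn [v /sub_kermxP vM v0] : kermx M != 0.
  rewrite kermx_eq0 /row_free neq_ltn; apply/orP; left.
  exact: leq_ltn_trans (rank_leq_col M) ltJI.
have [nd ndP] := choice (fun i => fraction_numden (v 0 i)).
pose c i := (nd i).1 * \prod_(k | k != i) (nd k).2.
have cE i : tofrac (c i) = v 0 i * tofrac (\prod_k (nd k).2).
  rewrite (bigD1 i) //= /c !tofracM mulrA; congr (_ * _).
  by rewrite -(ndP i).2.
exists (fun i => c (enum_rank i)); split.
  have /rV0Pn [i vi] := v0.
  exists (enum_val i); rewrite enum_valK -tofrac_eq0 cE mulf_neq0 //.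
  by rewrite tofrac_eq0; apply/prodf_neq0 => k _; case: (ndP k).
move=> j; apply/eqP; rewrite -tofrac_eq0 rmorph_sum /=.
under eq_bigr do rewrite tofracM cE mulrAC.
rewrite -mulr_suml mulf_eq0; apply/orP; left; apply/eqP.
have /matrixP/(_ 0 (enum_rank j)) := vM; rewrite !mxE; apply: etrans.
rewrite [RHS](reindex enum_rank) /=; last exact/onW_bij/enum_rank_bij.
by apply: eq_bigr => i _; rewrite mxE !enum_rankK.
Qed.

(** * Algebraic dependence and chains of primes *)

Section AlgebraicDependence.
Variables (T : idomainType) (tau : {rmorphism T -> {poly T}}).
Variable theta : {rmorphism {poly T} -> T}.
Hypotheses (tauK : cancel tau theta) (thetaK : cancel theta tau).

Local Notation shift_iter := (shift_iter theta).

(** Exponent vectors of length [k] with entries below [N], nested so as to follow the splitting off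
    of the first variable. *)
Fixpoint monomial_index (N k : nat) : finType :=
  if k is k'.+1 then ('I_N * monomial_index N k')%type else unit.

Fixpoint monomial (N k : nat) : monomial_index N k -> T :=
  if k is k'.+1 then fun i => theta ((monomial i.2)%:P * 'X^(i.1))
  else fun=> 1.

Lemma card_monomial_index N k : #|monomial_index N k| = (N ^ k)%N.
Proof.
elim: k => [|k IH] /=; first by rewrite card_unit.
by rewrite card_prod card_ord IH expnS.
Qed.

Lemma monomial_sum N k (c : 'I_N * monomial_index N k -> T) :
  \sum_i shift_iter k.+1 (c i) * @monomial N k.+1 i =
  theta (\sum_(i < N) (\sum_a shift_iter k (c (i, a)) * monomial a) *: 'X^i).
Proof.
transitivity (\sum_(i < N) \sum_a
    shift_iter k.+1 (c (i, a)) * @monomial N k.+1 (i, a)).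
  by rewrite pair_bigA; apply: eq_bigr => -[i a].
rewrite rmorph_sum.
apply: eq_bigr => i _; rewrite scaler_suml rmorph_sum; apply: eq_bigr => a _ /=.
by rewrite -rmorphM; congr (theta _); rewrite mulrA -polyCM mul_polyC.
Qed.

Lemma monomial_free N k (c : monomial_index N k -> T) :
  \sum_i shift_iter k (c i) * monomial i = 0 -> forall i, c i = 0.
Proof.
elim: k c => [|k IH] c.
  by rewrite (big_pred1 tt) => [|[]//]; rewrite mulr1 => h [].
rewrite monomial_sum => /eqP; rewrite (theta_eq0 thetaK) => /eqP h [i a].
apply: (IH (fun a => c (i, a))).
have := congr1 (fun p : {poly T} => p`_i) h; rewrite coef0 coef_sum.
rewrite (bigD1 i) //= coefZ coefXn eqxx mulr1 [X in _ + X]big1 ?addr0 => [//|j ji].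
by rewrite coefZ coefXn eq_sym (inj_eq val_inj) (negPf ji) mulr0.
Qed.

(** As [size] is the degree plus one, this bounds the degree in each of the first [k] variables
    strictly by [M]. *)
Fixpoint deg_bounded (k M : nat) (f : T) : Prop :=
  if k is k'.+1 then
    (size (tau f) <= M)%N /\ forall i, deg_bounded k' M (tau f)`_i
  else True.

Lemma deg_bounded_span k M f : deg_bounded k M f ->
  exists d : monomial_index M k -> T,
    f = \sum_i shift_iter k (d i) * monomial i.
Proof.
elim: k f => [|k IH] f /= => [_|[sf hf]].
  by exists (fun=> f); rewrite (big_pred1 tt) => [|[]//]; rewrite mulr1.
have [d dP] := choice (fun i => IH _ (hf i)).
exists (fun i : 'I_M * monomial_index M k => d i.1 i.2).
rewrite (@monomial_sum M k) /= -[LHS]tauK; congr (theta _).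
under eq_bigr do rewrite -dP.
rewrite -(poly_def M (fun i => (tau f)`_i)).
by apply/polyP => i; rewrite coef_poly; case: ltnP => // /(leq_sizeP _ _ sf) ->.
Qed.

Lemma deg_bounded_mono k M N f : (M <= N)%N ->
  deg_bounded k M f -> deg_bounded k N f.
Proof.
move=> leMN; elim: k f => //= k IH f [sf hf]; split; first exact: leq_trans leMN.
by move=> i; apply: IH.
Qed.

Lemma deg_bounded0 k M : deg_bounded k M 0.
Proof.
elim: k => //= k IH; rewrite rmorph0 size_poly0; split=> // i.
by rewrite coef0.
Qed.

Lemma deg_boundedD k M f g :
  deg_bounded k M f -> deg_bounded k M g -> deg_bounded k M (f + g).
Proof.
elim: k f g => //= k IH f g [sf hf] [sg hg]; rewrite rmorphD; split.
  by rewrite (leq_trans (size_polyD _ _)) // geq_max sf.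
by move=> i; rewrite coefD; apply: IH.
Qed.

Lemma deg_boundedM k M N f g :
  deg_bounded k M f -> deg_bounded k N g -> deg_bounded k (M + N) (f * g).
Proof.
elim: k f g => //= k IH f g [sf hf] [sg hg]; rewrite rmorphM; split.
  apply: leq_trans (size_polyMleq _ _) _.
  exact: leq_trans (leq_pred _) (leq_add sf sg).
move=> i; rewrite coefM; elim/big_ind: _ => [||j _]; last exact: IH.
  exact: deg_bounded0.
exact: deg_boundedD.
Qed.

Lemma deg_bounded1 k : deg_bounded k 1 1.
Proof.
elim: k => //= k IH; rewrite rmorph1 size_poly1; split=> // i.
by rewrite coef1; case: eqP => _ //; apply: deg_bounded0.
Qed.

Lemma deg_boundedX k M f j :
  deg_bounded k M f -> deg_bounded k (j * M).+1 (f ^+ j).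
Proof.
move=> hf; elim: j => [|j IH]; first by rewrite expr0; apply: deg_bounded1.
by rewrite exprS mulSn -addnS; apply: deg_boundedM.
Qed.

Lemma deg_bounded_ex k f : exists M, deg_bounded k M f.
Proof.
elim: k f => [|k IH] f /=; first by exists 0%N.
have [M hM] := choice (fun i => IH (tau f)`_i).
exists (maxn (size (tau f)) (\max_(i < size (tau f)) M i)).
split; first exact: leq_maxl.
move=> i; have [lti|gei] := ltnP i (size (tau f)); last first.
  by rewrite nth_default //; apply: deg_bounded0.
apply: deg_bounded_mono (hM i); apply: leq_trans (leq_maxr _ _).
exact: (leq_bigmax (Ordinal lti)).
Qed.

Section Evaluation.
Variable n : nat.

(* An element of T is regarded as a polynomial in the first k variables over
   the image of the k-th shift: that coefficient ring is mapped to the image of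
   the n-th shift, and the i-th variable to [a i]. *)
Fixpoint subst_iter (k : nat) (a : nat -> T) : {rmorphism T -> T} :=
  if k is k'.+1 then GRing.RMorphism.clone T T
    (horner_eval (a 0%N) \o (map_poly (subst_iter k' (a \o S)) \o tau)) _
  else shift_iter n.

Lemma subst_iterS k a f :
  subst_iter k.+1 a f = (map_poly (subst_iter k (a \o S)) (tau f)).[a 0%N].
Proof. by []. Qed.

Lemma subst_shift_iter k a c : subst_iter k a (shift_iter k c) = shift_iter n c.
Proof.
elim: k a => // k IH a; rewrite subst_iterS shift_iterS thetaK map_polyC hornerC.
exact: IH.
Qed.

Lemma subst_monomial_bounded k N D a (i : monomial_index N k) :
  (forall j, (j < k)%N -> deg_bounded n D (a j)) ->
  deg_bounded n (k * (N * D).+1).+1 (subst_iter k a (monomial i)).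
Proof.
elim: k a i => [|k IH] a i ha.
  by rewrite -[monomial i]/(1 : T) rmorph1; apply: deg_bounded1.
case: i => i b; rewrite subst_iterS -[monomial _]/(theta ((monomial b)%:P * 'X^i)).
rewrite thetaK rmorphM /= map_polyC map_polyXn hornerM hornerC hornerXn.
apply: (@deg_bounded_mono _ ((k * (N * D).+1).+1 + (i * D).+1)).
  have := ltn_ord i; nia.
apply: deg_boundedM; last by apply: deg_boundedX; apply: ha.
by apply: IH => j jk; apply: (ha j.+1).
Qed.

(** By counting: the [N ^ n.+1] monomials with exponents below [N] are sent into the span of only
    [M ^ n] monomials, where [M] grows linearly with [N]. *)
Lemma algebraic_dependence (a : nat -> T) :
  exists f, f != 0 /\ subst_iter n.+1 a f = 0.
Proof.
have [D hD] : exists D, forall j, (j < n.+1)%N -> deg_bounded n D (a j).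
  have [M hM] := choice (fun j => deg_bounded_ex n (a j)).
  exists (\max_(j < n.+1) M j) => j jn; apply: deg_bounded_mono (hM j).
  exact: (leq_bigmax (Ordinal jn)).
(* Since [M <= N * (n.+1 * D.+1).+1], this choice of [N] gives [M ^ n < N ^ n.+1]. *)
pose N := ((n.+1 * D.+1).+1 ^ n).+1; pose M := (n.+1 * (N * D).+1).+1.
have hd (i : monomial_index N n.+1) : exists d : monomial_index M n -> T,
    subst_iter n.+1 a (monomial i) = \sum_j shift_iter n (d j) * monomial j.
  by apply: deg_bounded_span; apply: subst_monomial_bounded.
have [d dP] := choice hd.
have [|c [[i ci] hc]] := linear_dependence d.
  rewrite !card_monomial_index expnS.
  apply: (@leq_ltn_trans ((N * (n.+1 * D.+1).+1) ^ n)%N).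
    have leq_expr x y e : (x <= y)%N -> (x ^ e <= y ^ e)%N.
      by case: e => // e xy; rewrite leq_exp2r.
    apply: leq_expr; have : (0 < N)%N by [].
    by rewrite /M; move: {d dP hd M} N => N' N0; nia.
  by rewrite expnMn mulnC ltn_pmul2r ?expn_gt0.
(* Substitution turns the coefficient [shift_iter n.+1 (c i)] into [shift_iter n (c i)], so the
   linear relation between the [d i] applies. *)
exists (\sum_i shift_iter n.+1 (c i) * monomial i); split.
  by apply/eqP => /monomial_free /(_ i) ci0; rewrite ci0 eqxx in ci.
rewrite rmorph_sum.
under eq_bigr do rewrite rmorphM subst_shift_iter dP mulr_sumr.
rewrite exchange_big big1 // => j _.
under eq_bigr do rewrite mulrA -rmorphM.
by rewrite -mulr_suml -rmorph_sum hc rmorph0 mul0r.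
Qed.

(** Here [r] is the multiplicity of zero as a root of [tau f], and [g] is the constant term left
    after division by ['X^r]. *)
Lemma subst_lowest k a f : f != 0 -> exists g t r, g != 0 /\
  subst_iter k.+1 a f = (subst_iter k (a \o S) g + a 0%N * t) * a 0%N ^+ r.
Proof.
move=> f0; have [r [p]] := multiplicity_XsubC (tau f) 0.
rewrite (tau_eq0 tauK) f0 subr0 implyTb => p0 tf.
rewrite subst_iterS tf rmorphM rmorphXn /= map_polyX hornerM horner_exp hornerX.
elim/poly_ind: p p0 {tf} => [|p c _]; first by rewrite root0.
rewrite /root hornerMXaddC mulr0 add0r => c0.
exists c, (map_poly (subst_iter k (a \o S)) p).[a 0%N], r; split=> //.
congr (_ * _); rewrite rmorphD rmorphM /= map_polyX map_polyC hornerMXaddC.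
by rewrite addrC mulrC.
Qed.

(* Coquand and Lombardi: the lowest term, in the lexicographic order, of an
   algebraic relation between the [a i] forces its coefficient into the
   top of the chain. *)
Lemma chain_relation k (q : nat -> set T) (a : nat -> T) f :
  (forall i, (i <= k)%N -> prime_ideal (q i)) ->
  (forall i, (i < k)%N -> q i `<=` q i.+1) ->
  (forall i, (i < k)%N -> q i.+1 (a i)) ->
  (forall i, (i <= k)%N -> ~ q i (a i)) ->
  f != 0 -> q 0%N (subst_iter k.+1 a f) ->
  exists c t, c != 0 /\ q k (shift_iter n c + a k * t).
Proof.
have step j (q' : nat -> set T) (b : nat -> T) g : prime_ideal (q' 0%N) ->
    ~ q' 0%N (b 0%N) -> g != 0 -> q' 0%N (subst_iter j.+1 b g) ->
    exists h t, h != 0 /\ q' 0%N (subst_iter j (b \o S) h + b 0%N * t).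
  move=> hq0 q'b g0; have [h [t [r [h0 ->]]]] := subst_lowest j b g0.
  have [_ _ q0P] := hq0; case/q0P => [qg|/(prime_idealX hq0)//].
  by exists h, t.
elim: k q a f => [|k IH] q a f hq q_sub qa qNa f0 qf.
  exact: step (hq 0%N isT) (qNa 0%N isT) f0 qf.
have [g [t [g0 qg]]] := step k.+1 q a f (hq 0%N isT) (qNa 0%N isT) f0 qf.
have [[h0 hD hM] _ _] := hq 1%N isT.
(* Passing to [q 1] absorbs the multiple of [a 0]. At the last index no larger prime is at hand, and
   the multiple of [a k] stays. *)
have {}qg : q 1%N (subst_iter k.+1 (a \o S) g).
  rewrite -[X in q _ X](addrK (a 0%N * t)); apply: idealB => //.
    exact: q_sub.
  by rewrite mulrC; apply: hM; apply: qa.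
have [||||c [t' h]] := IH (q \o S) (a \o S) g _ _ _ _ g0 qg; last by exists c, t'.
- by move=> i ik; apply: hq.
- by move=> i ik; apply: q_sub.
- by move=> i ik; apply: qa.
- by move=> i ik; apply: qNa.
Qed.

End Evaluation.
End AlgebraicDependence.

(** * Gluing two comaximal kernels into one prime *)

Section Gluing.
Variables (T K : idomainType) (phi1 phi2 : {rmorphism T -> K}) (e : T).
Hypotheses (phi1e : phi1 e = 0) (phi2e : phi2 e = 1).
Hypotheses (phi1_surj : forall a, exists f, phi1 f = a)
           (phi2_surj : forall a, exists f, phi2 f = a).

Definition equalizer : set T := [set f | phi1 f = phi2 f].
Definition glue_denom : set T := [set u | equalizer u /\ phi1 u != 0].
(** This is the largest ideal of [T] inside [equalizer]: for [f] in such an ideal, [e * f] in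
    [equalizer] forces [phi2 f = 0], and then [phi1 f = 0]. *)
Definition conductor : set T := [set f | phi1 f = 0 /\ phi2 f = 0].

Local Notation B := equalizer.
Local Notation U := glue_denom.
Local Notation J := conductor.

Lemma equalizerM a b : B a -> B b -> B (a * b).
Proof. by rewrite /B /mkset !rmorphM => -> ->. Qed.
Lemma equalizerB a b : B a -> B b -> B (a - b).
Proof. by rewrite /B /mkset !rmorphB => -> ->. Qed.
Lemma equalizerD a b : B a -> B b -> B (a + b).
Proof. by rewrite /B /mkset !rmorphD => -> ->. Qed.
Lemma equalizer1 : B 1.
Proof. by rewrite /B /mkset !rmorph1. Qed.
Lemma conductor_equalizer f : J f -> B f.
Proof. by case; rewrite /B /mkset => -> ->. Qed.
Lemma conductorM f g : J g -> J (f * g).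
Proof. by case; rewrite /J /mkset !rmorphM => -> ->; rewrite !mulr0. Qed.
Lemma glue_denom1 : U 1.
Proof. by split; [exact: equalizer1 | rewrite rmorph1 oner_neq0]. Qed.
Lemma glue_denomM u v : U u -> U v -> U (u * v).
Proof.
move=> [Bu u0] [Bv v0]; split; first exact: equalizerM.
by rewrite rmorphM mulf_neq0.
Qed.
Lemma glue_denom_neq0 u : U u -> u != 0.
Proof. by move=> [_]; apply: contraNneq => ->; rewrite rmorph0. Qed.

Lemma glue_crt a b : exists f, phi1 f = a /\ phi2 f = b.
Proof.
have [f fa] := phi1_surj a; have [g gb] := phi2_surj b.
exists ((1 - e) * f + e * g); rewrite !rmorphD !rmorphM !rmorphB !rmorph1.
by rewrite phi1e phi2e fa gb; split; ring.
Qed.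

Lemma glue_denom_multiple f : phi1 f != 0 -> phi2 f != 0 -> exists b, U (f * b).
Proof.
(* Swapping the two values makes [f * b] take the value [phi1 f * phi2 f] on both sides. *)
move=> f1 f2; have [b [b1 b2]] := glue_crt (phi2 f) (phi1 f).
exists b; split; first by rewrite /B /mkset !rmorphM b1 b2 mulrC.
by rewrite rmorphM b1 mulf_neq0.
Qed.

Lemma glue_decomp t : exists a b, [/\ B a, B b & t = a + b * e].
Proof.
have [a [a1 a2]] := glue_crt (phi1 t) (phi1 t).
(* As [b * e] contributes only to [phi2], it has to make up the difference of the two values of
   [t]. *)
have [b [b1 b2]] := glue_crt (phi2 t - phi1 t) (phi2 t - phi1 t).
exists (t - b * e), b; split; last by ring.
  by rewrite /B /mkset !rmorphB !rmorphM phi1e phi2e b2; ring.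
by rewrite /B /mkset b1 b2.
Qed.

Lemma conductor_idem : J (e * (1 - e)).
Proof.
by split; rewrite rmorphM rmorphB rmorph1 ?phi1e ?phi2e ?subrr ?mul0r ?mulr0.
Qed.

Definition equalizer_module (I : set T) : Prop :=
  [/\ I 0, forall x y, I x -> I y -> I (x + y)
    & forall a x, B a -> I x -> I (a * x)].

Lemma equalizer_moduleB I x y : equalizer_module I -> I x -> I y -> I (x - y).
Proof.
case=> I0 ID IM Ix Iy; apply: ID => //; rewrite -mulN1r; apply: IM => //.
by rewrite /B /mkset !rmorphN !rmorph1.
Qed.

(** * Noetherianity of the equalizer relative to its denominators *)

Section GlueNoetherian.
Variable S : set T.
Hypothesis S_neq0 : forall s, S s -> phi1 s != 0 /\ phi2 s != 0.
Hypothesis S_noeth : noetherian_at S.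

(** Since [T = B + B e], generators over [T] together with their multiples by [e] generate over [B];
    multipliers in [S] are traded for multipliers in [U]. *)
Let ideal_fg (A : set T) : ideal A -> exists G : seq T,
  (forall g, g \in G -> A g) /\
  forall H, equalizer_module H -> saturated U H ->
    (forall g, g \in G -> H g) -> A `<=` H.
Proof.
move=> hA; have [A0 AD AM] := hA; have [G [GA hG]] := S_noeth hA.
exists (G ++ [seq e * g | g <- G]); split.
  move=> g; rewrite mem_cat => /orP [/GA//|/mapP [g' /GA ? ->]].
  exact: AM.
move=> H [H0 HD HM] satH HG f Af.
(* [H] is only a [B]-module, so [S_noeth] is applied to the largest ideal of [T] inside it. *)
suff: [set f | forall t, H (t * f)] f by move=> /(_ 1); rewrite mul1r.
apply: hG Af.
- split=> [t|x y Hx Hy t|a x Hx t]; first by rewrite mulr0.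
    by rewrite mulrDr; apply: HD.
  by rewrite mulrA.
- move=> s x Ss Hx t; have [s1 s2] := S_neq0 Ss.
  have [b Ub] := glue_denom_multiple s1 s2.
  apply: satH Ub _; have -> : s * b * (t * x) = b * t * (s * x) by ring.
  exact: Hx.
- move=> g gG t; have [a [b [Ba Bb ->]]] := glue_decomp t.
  have -> : (a + b * e) * g = a * g + b * (e * g) by ring.
  apply: HD; apply: HM => //; apply: HG; rewrite mem_cat ?gG //.
  by rewrite map_f ?orbT.
Qed.

(* The largest ideal A of T contained in I contains I * J. Modulo A, 1 - e acts
   as an idempotent: the part of I that it kills is an ideal of T, and so is
   the image of I up to A. *)
Lemma equalizer_noetherian (I : set T) : equalizer_module I -> I `<=` B ->
  exists G : seq T, (forall g, g \in G -> I g) /\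
  forall H, equalizer_module H -> saturated U H ->
    (forall g, g \in G -> H g) -> I `<=` H.
Proof.
move=> hI IB; have [I0 ID IM] := hI.
pose A : set T := [set f | forall t, I (t * f)].
have A_ideal : ideal A.
  split=> [t|x y Hx Hy t|a x Hx t]; first by rewrite mulr0.
    by rewrite mulrDr; apply: ID.
  by rewrite mulrA.
have [A0 AD AM] := A_ideal.
have AI x : A x -> I x by move=> /(_ 1); rewrite mul1r.
have IJA x j : I x -> J j -> A (x * j).
  move=> Ix Jj t; rewrite mulrCA mulrC; apply: IM => //.
  by apply: conductor_equalizer; apply: conductorM.
pose I1 : set T := [set x | I x /\ A ((1 - e) * x)].
pose E1 : set T := [set z | exists x a, [/\ I x, A a & z = (1 - e) * x + a]].
(* Modulo [A], multiplication by [t] on [(1 - e) I] agrees with multiplication by an element of [B],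
   because [e * (1 - e)] lies in [J]. *)
have mulE (t x : T) : I x -> exists a y, [/\ B a, A y &
    t * ((1 - e) * x) = (1 - e) * (a * x) + y].
  move=> Ix; have [a [b [Ba Bb ->]]] := glue_decomp t.
  exists a, (b * (x * (e * (1 - e)))); split=> //; last by ring.
  by apply: AM; apply: IJA => //; apply: conductor_idem.
have I1_ideal : ideal I1.
  split; first by split; rewrite ?mulr0.
    move=> x y [Ix Ax] [Iy Ay]; split; first exact: ID.
    by rewrite mulrDr; apply: AD.
  move=> t x [Ix Ax]; split; last by rewrite mulrCA; apply: AM.
  have [a [b [Ba Bb ->]]] := glue_decomp t.
  have -> : (a + b * e) * x = (a + b) * x - b * ((1 - e) * x) by ring.
  apply: equalizer_moduleB => //.
  by apply: IM => //; apply: equalizerD.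
have E1_ideal : ideal E1.
  split; first by exists 0, 0; split=> //; rewrite mulr0 addr0.
    move=> _ _ [x [a [Ix Aa ->]]] [y [b [Iy Ab ->]]].
    exists (x + y), (a + b); split; [exact: ID | exact: AD | by ring].
  move=> t _ [x [a [Ix Aa ->]]]; have [b [y [Bb Ay hy]]] := mulE t x Ix.
  exists (b * x), (y + t * a); split; first exact: IM.
    by apply: AD => //; apply: AM.
  by rewrite mulrDr hy addrA.
have [G1 [G1I hG1]] := ideal_fg I1_ideal.
have [G2 [G2E hG2]] := S_noeth E1_ideal.
have lift_ex z : exists x, z \in G2 -> I x /\ exists2 a, A a & z = (1 - e) * x + a.
  have [/G2E [x [a [Ix Aa ->]]]|_] := boolP (z \in G2); last by exists 0.
  by exists x => _; split=> //; exists a.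
have [l lP] := choice lift_ex.
exists (G1 ++ [seq l z | z <- G2]); split.
  move=> g; rewrite mem_cat => /orP [/G1I []//|/mapP [z /lP [Iz _] ->//]].
move=> H hH satH HG f If; have [H0 HD HM] := hH.
have HI1 : I1 `<=` H by apply: hG1 => // g gG; apply: HG; rewrite mem_cat gG.
(* [H2] consists of the elements that, up to a denominator and modulo [A], are [1 - e] times an
   element of [I] lying in [H]. It is an [S]-saturated ideal of [T]. *)
pose H2 : set T := [set z | exists u h,
  [/\ U u, I h, H h & A (u * z - (1 - e) * h)]].
have : H2 ((1 - e) * f).
  apply: hG2; last by exists f, 0; rewrite addr0.
  - split.
    + by exists 1, 0; rewrite !mulr0 subr0; split=> //; exact: glue_denom1.
    + move=> x y [u [h [Uu Ih Hh hx]]] [v [k [Uv Ik Hk hy]]].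
      have [Bu _] := Uu; have [Bv _] := Uv.
      exists (u * v), (v * h + u * k); split; first exact: glue_denomM.
      * by apply: ID; apply: IM.
      * by apply: HD; apply: HM.
      have -> : u * v * (x + y) - (1 - e) * (v * h + u * k) =
        v * (u * x - (1 - e) * h) + u * (v * y - (1 - e) * k) by ring.
      by apply: AD; apply: AM.
    + move=> t x [u [h [Uu Ih Hh hx]]].
      have [a [y [Ba Ay hy]]] := mulE t h Ih.
      exists u, (a * h); split; [by [] | exact: IM | exact: HM |].
      have -> : u * (t * x) - (1 - e) * (a * h) = t * (u * x - (1 - e) * h) + y.
        by rewrite mulrBr hy; ring.
      by apply: AD => //; apply: AM.
  - move=> s z Ss [u [h [Uu Ih Hh hz]]]; have [s1 s2] := S_neq0 Ss.
    have [b Usb] := glue_denom_multiple s1 s2.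
    have [a [y [Ba Ay hy]]] := mulE b h Ih.
    exists (u * (s * b)), (a * h); split; [exact: glue_denomM | exact: IM |
      exact: HM |].
    have -> : u * (s * b) * z - (1 - e) * (a * h) =
      b * (u * (s * z) - (1 - e) * h) + y by rewrite mulrBr hy; ring.
    by apply: AD => //; apply: AM.
  - move=> z zG; have [Iz [a Aa ->]] := lP z zG.
    exists 1, (l z); split=> //; first exact: glue_denom1.
      by apply: HG; rewrite mem_cat map_f ?orbT.
    by rewrite mul1r addrAC subrr add0r.
case=> u [h [Uu Ih Hh hz]]; apply: (satH u) => //.
(* [u * f - h] is in [I] and is killed by [1 - e] modulo [A], so it falls in [I1], which is inside
   [H]. *)
rewrite -[u * f](subrK h); apply: HD => //; apply: HI1; split.
  by have [Bu _] := Uu; apply: equalizer_moduleB => //; apply: IM.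
by rewrite mulrBr mulrCA.
Qed.

End GlueNoetherian.

(** * The local ring as a ring of fractions of the equalizer *)

Lemma exists_glued_ring :
  exists (R : idomainType) (i : {rmorphism R -> {fraction T}}),
    injective i /\ forall x, (exists r, i r = x) <->
      exists f u, [/\ B f, U u & x * tofrac u = tofrac f].
Proof.
pose D : {pred {fraction T}} := fun x =>
  `[< exists f u, [/\ B f, U u & x * tofrac u = tofrac f] >].
have D_subring : subring_closed D.
  split.
  - apply/asboolP; exists 1, 1; split; [exact: equalizer1 | exact: glue_denom1 |].
    by rewrite mul1r.
  - move=> x y /asboolP [f [u [Bf Uu xu]]] /asboolP [g [v [Bg Uv yv]]].
    apply/asboolP; exists (f * v - g * u), (u * v).
    have [Bu _] := Uu; have [Bv _] := Uv; split; last 1 first.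
    + by rewrite tofracB !tofracM -xu -yv; ring.
    + by apply: equalizerB; apply: equalizerM.
    + exact: glue_denomM.
  - move=> x y /asboolP [f [u [Bf Uu xu]]] /asboolP [g [v [Bg Uv yv]]].
    apply/asboolP; exists (f * g), (u * v); split; last 1 first.
    + by rewrite !tofracM -xu -yv; ring.
    + exact: equalizerM.
    + exact: glue_denomM.
have D_integral x y : x \in D -> y \in D -> x * y = 0 -> x = 0 \/ y = 0.
  by move=> _ _ /eqP; rewrite mulf_eq0 => /orP [] /eqP; [left|right].
have [R [i [i_inj iP]]] := integral_subring_idomain D_subring D_integral.
exists R, i; split=> // x; split=> [/iP /asboolP//|hx].
by apply/iP/asboolP.
Qed.

Section GluedRing.
Variables (R : idomainType) (i : {rmorphism R -> {fraction T}}).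
Hypothesis i_inj : injective i.
Hypothesis iP : forall x, (exists r, i r = x) <->
  exists f u, [/\ B f, U u & x * tofrac u = tofrac f].

Definition contraction (I : set R) : set T :=
  [set f | exists2 r, I r & i r = tofrac f].
Definition extension (A : set T) : set R :=
  [set r | exists f u, [/\ A f, U u & i r * tofrac u = tofrac f]].

Lemma glue_rep r : exists f u, [/\ B f, U u & i r * tofrac u = tofrac f].
Proof. by apply/iP; exists r. Qed.

Lemma glue_lift f : B f -> exists r, i r = tofrac f.
Proof.
move=> Bf; apply/iP; exists f, 1; rewrite mulr1; split=> //.
exact: glue_denom1.
Qed.

(** Two fractions for [r] have equal cross products; [phi1] and [phi2] agree on three of the four
    factors, hence on [f]. This lets [extension] take numerators from any prime of [T]. *)
Lemma glue_rep_equalizer r f u : U u -> i r * tofrac u = tofrac f -> B f.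
Proof.
move=> [Bu u0] ru; have [g [v [Bg [Bv v0] rv]]] := glue_rep r.
have fv : f * v = g * u.
  by apply/eqP; rewrite -tofrac_eq !tofracM -ru -rv; apply/eqP; ring.
apply: (mulIf v0); rewrite -rmorphM fv rmorphM Bg Bu -rmorphM -fv rmorphM.
by rewrite -Bv.
Qed.

Lemma contraction_equalizer I : contraction I `<=` B.
Proof.
move=> f [r _ rf]; apply: (@glue_rep_equalizer r f 1); first exact: glue_denom1.
by rewrite rmorph1 mulr1.
Qed.

Lemma glue_unit u : U u -> exists v r, i r = tofrac u /\ v * r = 1.
Proof.
move=> Uu; have [Bu u0] := Uu; have [r ru] := glue_lift Bu.
have [v vu] : exists v, i v = (tofrac u)^-1.
  apply/iP; exists 1, u; split=> //; first exact: equalizer1.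
  by rewrite mulVf ?tofrac_eq0 ?glue_denom_neq0 // rmorph1.
exists v, r; split=> //; apply: i_inj.
by rewrite rmorphM rmorph1 ru vu mulVf // tofrac_eq0 glue_denom_neq0.
Qed.

Lemma contraction_rep (I : set R) r f u : ideal I -> U u ->
  i r * tofrac u = tofrac f -> I r <-> contraction I f.
Proof.
move=> [I0 ID IM] Uu rf; have [v [w [wu vw]]] := glue_unit Uu; split=> [Ir|[s Is sf]].
  by exists (w * r); [exact: IM | rewrite rmorphM wu mulrC].
suff -> : r = v * s by apply: IM.
have ivw : i v * i w = 1 by rewrite -rmorphM vw rmorph1.
by apply: i_inj; rewrite rmorphM sf -rf -wu mulrCA ivw mulr1.
Qed.

Lemma contraction_module I : ideal I -> equalizer_module (contraction I).
Proof.
move=> [I0 ID IM]; split.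
- by exists 0; rewrite ?rmorph0.
- move=> x y [r Ir rx] [s Is sy]; exists (r + s); first exact: ID.
  by rewrite !rmorphD rx sy.
- move=> a x Ba [r Ir rx]; have [s sa] := glue_lift Ba.
  by exists (s * r); [exact: IM | rewrite !rmorphM rx sa].
Qed.

Lemma contraction_subset I I' : ideal I -> ideal I' ->
  contraction I `<=` contraction I' -> I `<=` I'.
Proof.
move=> hI hI' sub r Ir; have [f [u [Bf Uu rf]]] := glue_rep r.
by apply/(contraction_rep hI' Uu rf)/sub/(contraction_rep hI Uu rf).
Qed.

Lemma contraction_saturated I : ideal I -> saturated U (contraction I).
Proof.
move=> hI u f Uu [r Ir rf].
have : exists s, i s = tofrac f.
  apply/iP; exists (u * f), u; split=> //; last by rewrite -rmorphM mulrC.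
  by apply: contraction_equalizer; exists r; [exact: Ir | exact: rf].
move=> [s sf]; exists s => //; apply/(contraction_rep (f := u * f) hI Uu).
  by rewrite sf -rmorphM mulrC.
by exists r.
Qed.

Lemma contraction_proper I : ideal I -> ~ I 1 -> contraction I `<=` J.
Proof.
move=> hI I1 f If; have Bf := contraction_equalizer If.
suff f1 : phi1 f = 0 by split; rewrite -?Bf.
have [//|f1] := eqVneq (phi1 f) 0; case: I1.
have Uf : U f by split.
by apply/(contraction_rep hI Uf); first by rewrite rmorph1 mul1r.
Qed.

Lemma contraction_extension (P : set T) : prime_ideal P ->
  (forall u, U u -> ~ P u) -> contraction (extension P) = P `&` B.
Proof.
move=> [_ _ hP] PU; apply/seteqP; split=> [f|f [Pf Bf]].
  move=> hf; split; last exact: contraction_equalizer hf.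
  move: hf => [r [g [u [Pg Uu rg]]] rf].
  have : P (f * u).
    suff -> : f * u = g by [].
    by apply/eqP; rewrite -tofrac_eq tofracM -rf rg.
  by case/hP => // /(PU u Uu).
have [r rf] := glue_lift Bf; exists r => //; exists f, 1; split=> //.
  exact: glue_denom1.
by rewrite rf rmorph1 mulr1.
Qed.

Lemma extension_prime (P : set T) : prime_ideal P ->
  (forall u, U u -> ~ P u) -> prime_ideal (extension P).
Proof.
move=> [[P0 PD PM] P1 hP] PU; split.
- split.
  + by exists 0, 1; rewrite rmorph0 mul0r; split=> //; exact: glue_denom1.
  + move=> x y [f [u [Pf Uu xu]]] [g [v [Pg Uv yv]]].
    exists (v * f + u * g), (u * v); split.
    * by apply: PD; apply: PM.
    * exact: glue_denomM.
    * by rewrite rmorphD tofracD !tofracM -xu -yv; ring.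
  + move=> a x [f [u [Pf Uu xu]]]; have [g [v [Bg Uv av]]] := glue_rep a.
    exists (g * f), (v * u); split; [exact: PM | exact: glue_denomM |].
    by rewrite rmorphM !tofracM -xu -av; ring.
- case=> f [u [Pf Uu]]; rewrite rmorph1 mul1r => /eqP; rewrite tofrac_eq.
  by move=> /eqP uf; apply: (PU u) => //; rewrite uf.
- move=> x y [h [w [Ph Uw xyw]]].
  have [f [u [Bf Uu xu]]] := glue_rep x; have [g [v [Bg Uv yv]]] := glue_rep y.
  have : P ((f * g) * w).
    suff -> : f * g * w = u * v * h by apply: PM.
    apply/eqP; rewrite -tofrac_eq !tofracM -xu -yv -xyw rmorphM.
    by apply/eqP; ring.
  case/hP => [/hP [Pf|Pg]|/(PU w Uw)//]; [left|right].
    by exists f, u.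
  by exists g, v.
Qed.

Lemma glued_noetherian (S : set T) :
  (forall s, S s -> phi1 s != 0 /\ phi2 s != 0) -> noetherian_at S ->
  noetherian R.
Proof.
move=> S0 hS I hI.
have [G [GI hG]] := equalizer_noetherian S0 hS (contraction_module hI)
  (@contraction_equalizer I).
have lift_ex (k : 'I_(size G)) : exists r, I r /\ i r = tofrac G`_k.
  by have [r Ir rf] := GI _ (mem_nth 0 (ltn_ord k)); exists r.
have [g gP] := choice lift_ex.
exists (size G), g; have [I0 ID IM] := hI.
have gen_ideal : ideal (generated_ideal g).
  split.
  - by exists (fun=> 0); rewrite big1 // => k _; rewrite mul0r.
  - move=> _ _ [c ->] [d ->]; exists (fun k => c k + d k).
    by rewrite -big_split; apply: eq_bigr => k _; rewrite mulrDl.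
  - move=> a _ [c ->]; exists (fun k => a * c k).
    by rewrite mulr_sumr; apply: eq_bigr => k _; rewrite mulrA.
apply/seteqP; split; last first.
  move=> _ [c ->]; elim/big_ind: _ => [//|//|k _].
  by apply: IM; case: (gP k).
apply: contraction_subset => //; apply: hG.
- exact: contraction_module.
- exact: contraction_saturated.
- move=> f /(nthP 0) [k kG <-]; exists (g (Ordinal kG)); last first.
    by case: (gP (Ordinal kG)).
  exists (fun j => (j == Ordinal kG)%:R).
  rewrite (bigD1 (Ordinal kG)) //= eqxx mul1r big1 ?addr0 // => j /negPf ->.
  by rewrite mul0r.
Qed.

(** Both kernels meet [B] in [J], so they give the same prime of [R]. *)
Lemma conductor_extension : extension J = extension [set f | phi1 f = 0].
Proof.
apply/seteqP; split=> r [f [u [Jf Uu rf]]]; exists f, u; split=> //.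
  by case: Jf.
have Bf := glue_rep_equalizer Uu rf.
by split=> //; rewrite -Bf.
Qed.

Lemma conductor_extension2 : extension J = extension [set f | phi2 f = 0].
Proof.
apply/seteqP; split=> r [f [u [Jf Uu rf]]]; exists f, u; split=> //.
  by case: Jf.
have Bf := glue_rep_equalizer Uu rf.
by split=> //; rewrite Bf.
Qed.

Lemma conductor_extension_prime : prime_ideal (extension J).
Proof.
rewrite conductor_extension; apply: extension_prime.
  exact: rmorph_ker_prime.
by move=> u [_ /eqP].
Qed.

Lemma ideal_sub_conductor I : ideal I -> ~ I 1 -> I `<=` extension J.
Proof.
move=> hI I1 r Ir; have [f [u [Bf Uu rf]]] := glue_rep r.
exists f, u; split=> //; apply: (contraction_proper hI I1).
exact/(contraction_rep hI Uu rf).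
Qed.

Lemma conductor_maximal : maximal_ideal (extension J).
Proof.
have [hJ J1 _] := conductor_extension_prime; split=> // I hI I1 JI.
by apply/seteqP; split=> //; apply: ideal_sub_conductor.
Qed.

Lemma glued_local_ring : noetherian R -> local_ring R.
Proof.
move=> hR; split=> //; exists (extension J); split.
  exact: conductor_maximal.
move=> M [hM M1 Mmax]; have [hJ J1 _] := conductor_extension_prime.
exact/Mmax/ideal_sub_conductor.
Qed.

(** * Lifting the non-maximal primes of R to T *)

Definition hat (q : set T) : set T := [set f | forall j, J j -> q (f * j)].

Section Hat.
Variable Q : set R.
Hypotheses (hQ : prime_ideal Q) (QJ : exists2 j, J j & ~ contraction Q j).
Let q := contraction Q.

Let qP x y : B x -> B y -> q (x * y) -> q x \/ q y.
Proof.
move=> Bx By [r Qr rxy]; have [s sx] := glue_lift Bx; have [t ty] := glue_lift By.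
have rst : r = s * t by apply: i_inj; rewrite rmorphM rxy sx ty rmorphM.
have [_ _ QP] := hQ; rewrite rst in Qr.
by have [Qs|Qt] := QP _ _ Qr; [left; exists s | right; exists t].
Qed.

(** [hat q] is the colon ideal of [q] by [J], the prime of [T] over [q]. Multiplying by elements of
    [J] moves elements of [T] into [B], where the primality of [q] applies. *)
Lemma hat_prime : prime_ideal (hat q).
Proof.
have [hQI Q1 QP] := hQ; have [q0 qD qM] := contraction_module hQI.
split.
- split=> [j _|x y hx hy j Jj|a x hx j Jj]; first by rewrite mul0r.
    by rewrite mulrDl; apply: qD; [apply: hx | apply: hy].
  by rewrite -mulrA mulrCA; apply: hx; apply: conductorM.
- by have [j Jj qj] := QJ; move=> /(_ j Jj); rewrite mul1r.
- move=> x y hxy; have [hx|/existsNP [j /not_implyP [Jj qxj]]] := pselect (hat q x).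
    by left.
  right=> k Jk; have [] // := @qP (x * j) (y * k).
  + exact/conductor_equalizer/conductorM.
  + exact/conductor_equalizer/conductorM.
  + have -> : x * j * (y * k) = x * y * (j * k) by ring.
    by apply: hxy; apply: conductorM.
Qed.

Lemma hat_equalizer f : B f -> hat q f <-> q f.
Proof.
have [hQI _ _] := hQ; have [q0 qD qM] := contraction_module hQI.
move=> Bf; have [j Jj qj] := QJ; split=> [/(_ j Jj)|qf k Jk].
  by case/(qP Bf (conductor_equalizer Jj)).
by rewrite mulrC; apply: qM => //; apply: conductor_equalizer.
Qed.

(** An element outside both kernels has a multiple in [U], which would be a unit of [R] inside
    [Q]. *)
Lemma hat_nonunit f : hat q f -> phi1 f = 0 \/ phi2 f = 0.
Proof.
have [hQI Q1 _] := hQ; move=> qf.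
have [->|f1] := eqVneq (phi1 f) 0; first by left.
have [->|f2] := eqVneq (phi2 f) 0; first by right.
have [b [Bb b0]] := glue_denom_multiple f1 f2.
have [[_ _ hM] _ _] := hat_prime.
have /(hat_equalizer Bb)/(contraction_proper hQI Q1) [fb0 _] : hat q (f * b).
  by rewrite mulrC; apply: hM.
by rewrite fb0 eqxx in b0.
Qed.

End Hat.
End GluedRing.
End Gluing.

(** * Dimension and saturated chains of the glued ring *)

Section Chains.
Variables (T : idomainType) (tau : {rmorphism T -> {poly T}}).
Variable theta : {rmorphism {poly T} -> T}.
Hypotheses (tauK : cancel tau theta) (thetaK : cancel theta tau).
Variables (m n : nat) (hm : (1 < m)%N) (hmn : (m < n)%N).

Local Notation phi1 := (eval_iter tau 0 n).
Local Notation phi2 := (eval_iter tau 1 m).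
Local Notation B := (equalizer phi1 phi2).
Local Notation U := (glue_denom phi1 phi2).
Local Notation J := (conductor phi1 phi2).

Let e := theta 'X.

Let phi1e : phi1 e = 0.
Proof. by case: n hmn => // n' _; rewrite eval_iter_head // rmorph0. Qed.

Let phi2e : phi2 e = 1.
Proof. by case: m hm => // m' _; rewrite eval_iter_head // rmorph1. Qed.

Let phi1_surj a : exists f, phi1 f = a.
Proof. by exists (shift_iter theta n a); rewrite eval_shift_iter. Qed.

Let phi2_surj a : exists f, phi2 f = a.
Proof. by exists (shift_iter theta m a); rewrite eval_shift_iter. Qed.

Let S_neq0 s : shift_nonzero theta n s -> phi1 s != 0 /\ phi2 s != 0.
Proof.
move=> [c c0 <-]; split; apply: eval_shift_iter_neq0 => //; exact: ltnW.
Qed.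

Variables (R : idomainType) (i : {rmorphism R -> {fraction T}}).
Hypothesis i_inj : injective i.
Hypothesis iP : forall x, (exists r, i r = x) <->
  exists f u, [/\ B f, U u & x * tofrac u = tofrac f].

Local Notation ext := (extension phi1 phi2 i).
Local Notation contr := (contraction i).

Lemma glued_shift_local : local_ring R.
Proof.
apply: (glued_local_ring i_inj iP).
apply: (glued_noetherian phi1e phi2e _ _ i_inj iP S_neq0) => //.
exact: shift_noetherian.
Qed.

Lemma strict_contraction (P Q : set R) : ideal P -> ideal Q -> P `<` Q ->
  exists2 f, contr Q f & ~ contr P f.
Proof.
move=> hP hQ [_ QP]; apply: contrapT => h; apply: QP.
apply: (contraction_subset i_inj iP) => // f Qf.
by apply: contrapT => Pf; apply: h; exists f.
Qed.

Lemma glued_dim_le k (C : 'I_k.+1 -> set R) : prime_chain C -> (k <= n)%N.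
Proof.
move=> [Cprime Clt]; rewrite leqNgt; apply/negP => ltnk.
(* Only indices up to [n.+1 <= k] matter, and there [inord] is exact. *)
pose D j := C (inord j).
have Dprime j : prime_ideal (D j) by apply: Cprime.
have Dideal j : ideal (D j) by case: (Dprime j).
have a_ex j : exists a, (j <= n)%N -> contr (D j.+1) a /\ ~ contr (D j) a.
  have [jn|_] := leqP j n; last by exists 0.
  have ltD : D j `<` D j.+1 by apply: Clt; rewrite !inordK; lia.
  by have [a ? ?] := strict_contraction (Dideal j) (Dideal j.+1) ltD; exists a.
have [a aP] := choice a_ex.
(* Each [a j] lies in a proper ideal, hence in [J], and so shows that [D j] does not contain [J].
   Thus [D 0] to [D n] all lift to primes of [T]. *)
have aJ j : (j <= n)%N -> J (a j).
  move=> /aP [h _]; have [hI h1 _] := Dprime j.+1.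
  exact: (contraction_proper i_inj iP hI h1 h).
have DJ j : (j <= n)%N -> exists2 x, J x & ~ contr (D j) x.
  by move=> jn; exists (a j); [exact: aJ | case: (aP j jn)].
have [f [f0 fa]] := algebraic_dependence tauK thetaK n a.
have [|||||c [t [c0 hc]]] := chain_relation (n := n) tauK (k := n)
    (q := fun j => hat phi1 phi2 (contr (D j))) (a := a) _ _ _ _ f0.
- by move=> j jn; apply: (hat_prime i_inj iP (Dprime j) (DJ j jn)).
- move=> j jn g hg x Jx; have [r Dr rE] := hg x Jx; exists r => //.
  have [Dsub _] : D j `<` D j.+1 by apply: Clt; rewrite !inordK; lia.
  exact: Dsub.
- move=> j jn; apply/(hat_equalizer i_inj iP (Dprime j.+1) (DJ j.+1 jn)).
    exact/conductor_equalizer/aJ/ltnW.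
  by case: (aP j (ltnW jn)).
- move=> j jn /(hat_equalizer i_inj iP (Dprime j) (DJ j jn)) h.
  have [_] := aP j jn; apply; apply: h; exact/conductor_equalizer/aJ.
- rewrite fa; have [[h0 _ _] _ _] := hat_prime i_inj iP (Dprime 0%N) (DJ 0%N isT).
  exact: h0.
(* Both homomorphisms kill [a n], so by [hat_nonunit] one of them would kill [shift_iter theta n c],
   which [S_neq0] forbids. *)
have [a1 a2] := aJ n (leqnn n).
have [s1 s2] : phi1 (shift_iter theta n c) != 0 /\ phi2 (shift_iter theta n c) != 0.
  by apply: S_neq0; exists c.
have := hat_nonunit phi1e phi2e _ _ i_inj iP (Dprime n) (DJ n (leqnn n)) hc.
rewrite !rmorphD !rmorphM a1 a2 !mul0r !addr0.
by case=> [//|//|/eqP|/eqP]; apply/negP.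
Qed.

(** * The saturated chain along one of the two kernels *)

Section Side.
(* Applied to (c, N) = (0, n), g = 1 - e, psi = phi2 and to
   (c, N) = (1, m), g = e, psi = phi1. *)
Variables (c : T) (N : nat) (g : T) (psi : {rmorphism T -> T}).
Hypotheses (N_gt1 : (1 < N)%N) (evalg : eval_iter tau c N g = 1) (psig : psi g = 0).
Hypothesis evalNg : eval_iter tau c 1 (1 - g) = 0.
Hypothesis JE : forall f, J f <-> eval_iter tau c N f = 0 /\ psi f = 0.
Hypothesis extJ : ext J = ext [set f | eval_iter tau c N f = 0].
Hypothesis evalU : forall u, U u -> eval_iter tau c N u != 0.
Hypothesis nonunit : forall Q : set R, prime_ideal Q ->
  (exists2 j, J j & ~ contr Q j) -> forall f, hat phi1 phi2 (contr Q) f ->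
  eval_iter tau c N f = 0 \/ psi f = 0.

Let ker k : set T := [set f | eval_iter tau c k f = 0].
Let D k := ext (ker k).

Let ker_prime k : prime_ideal (ker k).
Proof. exact: rmorph_ker_prime. Qed.

Let ker_U k u : (k <= N)%N -> U u -> ~ ker k u.
Proof.
move=> kN Uu /(eval_iter_ker_mono kN) h; have := evalU Uu.
by rewrite h eqxx.
Qed.

Let D_prime k : (k <= N)%N -> prime_ideal (D k).
Proof. by move=> kN; apply: (extension_prime iP) => // u; apply: ker_U. Qed.

Let contrD k : (k <= N)%N -> contr (D k) = ker k `&` B.
Proof. by move=> kN; apply: (contraction_extension iP) => // u; apply: ker_U. Qed.

(** Multiplying a witness of [ker k.+1] against [ker k] by [g] puts it into the kernel of [psi],
    hence into [J]; it stays outside [ker k] because [g] is sent to 1 at stage [N]. *)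
Let J_ker k : (k < N)%N ->
  exists w, [/\ J w, eval_iter tau c k w != 0 & ker k.+1 w].
Proof.
move=> kN; have [w [w0 w1]] := eval_iter_ker_strict thetaK c k.
have wN := eval_iter_ker_mono kN w1.
exists (g * w); split; last by rewrite /ker /mkset rmorphM w1 mulr0.
  by apply/JE; rewrite !rmorphM wN psig mulr0 mul0r.
rewrite rmorphM mulf_neq0 //; apply/eqP => /(eval_iter_ker_mono (ltnW kN)) /eqP.
by rewrite evalg oner_eq0.
Qed.

Lemma side_chain : prime_chain (fun k : 'I_N.+1 => D k).
Proof.
split=> [k|j k jk]; first by apply: D_prime; rewrite -ltnS.
have kN : (k <= N)%N by rewrite -ltnS.
split; first by move=> r [f [u [/(eval_iter_ker_mono (ltnW jk)) Pf Uu rf]]]; exists f, u.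
have [w [Jw w0 w1]] := J_ker (leq_trans jk kN).
have Bw := conductor_equalizer Jw.
have : contr (D k) w by rewrite contrD //; split=> //; apply: eval_iter_ker_mono w1.
move=> [r Dr rw] /(_ r Dr) Dj.
have : contr (D j) w by exists r.
rewrite contrD ?(ltnW (leq_trans jk kN)) // => -[/eqP].
by rewrite (negPf w0).
Qed.

(** Lifted to [T], an intermediate prime is trapped between two consecutive kernels, so
    [eval_iter_ker_saturated] applies. *)
Lemma side_saturated :
  saturated_chain_between [set 0] (ext J) (fun k : 'I_N.+1 => D k).
Proof.
split; last by rewrite extJ.
  split; first exact: side_chain.
  move=> j k kj [Q [hQ jQ Qk]].
  have {Qk} Qk : Q `<` D j.+1 by move: Qk; rewrite kj.
  have jN : (j < N)%N by rewrite -ltnS -kj.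
  have [hQI Q1 _] := hQ.
  have [hDj _ _] := D_prime (ltnW jN); have [hDk Dk1 _] := D_prime jN.
  have [x Dx Qx] := strict_contraction hQI hDk Qk.
  have QJ : exists2 j, J j & ~ contr Q j.
    by exists x => //; apply: (contraction_proper i_inj iP hDk Dk1).
  have hP := hat_prime i_inj iP hQ QJ.
  have [[P0 PD PM] P1 PP] := hP.
  have kerP : ker j `<=` hat phi1 phi2 (contr Q).
    move=> f fj y Jy; have : contr (D j) (f * y).
      rewrite contrD; last exact: ltnW.
      split; last exact/conductor_equalizer/conductorM.
      by rewrite /ker /mkset rmorphM fj mul0r.
    by case=> r Dr rE; exists r => //; case: jQ => sub _; apply: sub.
  have Pker : hat phi1 phi2 (contr Q) `<=` ker j.+1.
    (* Below the top, an element of [J] outside the prime [ker j.+1] can be cancelled. *)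
    move=> f Pf; have [j1N|] := ltnP j.+1 N.
      have [w [Jw w0 _]] := J_ker j1N.
      have [r Qr rE] := Pf w Jw.
      have : contr (D j.+1) (f * w) by exists r => //; case: Qk => sub _; apply: sub.
      rewrite contrD // => -[/eqP]; rewrite rmorphM mulf_eq0 (negPf w0) orbF.
      by move=> /eqP.
    (* At the top, [J] is inside [ker N]. Instead, [1 <= j] by [N_gt1], so [1 - g] is in [ker j] and
       [f + (1 - g)] is in the lift of [Q]. If [f] were outside [ker N], then [psi f = 0], and
       neither homomorphism would kill this sum. *)
    move=> Nj; have {Nj} Nj : N = j.+1 by apply/eqP; rewrite eqn_leq Nj.
    rewrite -Nj /ker /mkset; apply: contrapT => /eqP f0.
    have g1 : eval_iter tau c j (1 - g) = 0.
      apply: eval_iter_ker_mono evalNg; lia.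
    have gN : eval_iter tau c N (1 - g) = 0.
      by apply: eval_iter_ker_mono g1; apply: ltnW.
    have psif : psi f = 0.
      by have [/eqP|//] := nonunit hQ QJ Pf; rewrite (negPf f0).
    have [] := nonunit hQ QJ (PD _ _ Pf (kerP _ g1)).
      by rewrite rmorphD gN addr0; apply/eqP.
    rewrite rmorphD psif add0r rmorphB rmorph1 psig subr0.
    by apply/eqP; rewrite oner_eq0.
  have [f Qf Df] := strict_contraction hDj hQI jQ.
  have Bf := contraction_equalizer iP Qf.
  have kP : ker j.+1 `<=` hat phi1 phi2 (contr Q).
    apply: (eval_iter_ker_saturated tauK thetaK hP kerP Pker); exists f.
      exact/(hat_equalizer i_inj iP hQ QJ Bf).
    apply/eqP => f0; apply: Df; rewrite contrD; last exact: ltnW.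
    by split.
  rewrite contrD // in Dx; have [kx Bx] := Dx.
  by apply: Qx; apply/(hat_equalizer i_inj iP hQ QJ Bx); apply: kP.
(* [eval_iter tau c 0] is the identity, so the chain starts at zero. *)
apply/seteqP; split=> [r [f [u [f0 Uu]]]|r ->].
  rewrite [f]f0 rmorph0 => /eqP; rewrite mulf_eq0 tofrac_eq0.
  rewrite (negPf (glue_denom_neq0 Uu)) orbF => /eqP ir0.
  by apply: i_inj; rewrite ir0 rmorph0.
by have [[D0 _ _] _ _] := D_prime (leq0n N).
Qed.

End Side.

Let nonunit (Q : set R) : prime_ideal Q ->
  (exists2 j, J j & ~ contr Q j) -> forall f, hat phi1 phi2 (contr Q) f ->
  phi1 f = 0 \/ phi2 f = 0.
Proof.
by move=> hQ QJ f; apply: (hat_nonunit phi1e phi2e _ _ i_inj iP).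
Qed.

Lemma long_chain :
  saturated_chain_between [set 0] (ext J)
    (fun k : 'I_n.+1 => ext [set f | eval_iter tau 0 k f = 0]).
Proof.
apply: (@side_saturated 0 n (1 - e) phi2) => //.
- by rewrite (ltn_trans hm).
- by rewrite rmorphB rmorph1 phi1e subr0.
- by rewrite rmorphB rmorph1 phi2e subrr.
- by rewrite subKr (eval_iter_head thetaK) rmorph0.
- exact: (conductor_extension iP).
- by move=> u [].
Qed.

Lemma short_chain :
  saturated_chain_between [set 0] (ext J)
    (fun k : 'I_m.+1 => ext [set f | eval_iter tau 1 k f = 0]).
Proof.
apply: (@side_saturated 1 m e phi1) => //.
- by rewrite rmorphB rmorph1 (eval_iter_head thetaK) rmorph1 subrr.
- by move=> f; split; case.
- exact: (conductor_extension2 iP).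
- by move=> u [Bu]; rewrite Bu.
- by move=> Q hQ QJ f /(nonunit hQ QJ) [] ->; [right|left].
Qed.

Lemma glued_shift_noncatenary : ~ catenary R.
Proof.
move=> catR; have [[[primes lt] _] C0 CM] := long_chain.
have P0 := primes ord0; rewrite C0 in P0.
have PM := primes ord_max; rewrite CM in PM.
have ltM : [set 0] `<` ext J.
  by rewrite -C0 -CM; apply: lt; rewrite /= (ltn_trans _ hmn) // (ltn_trans _ hm).
have := catR _ _ P0 PM ltM _ _ _ _ long_chain short_chain.
by move: hmn => /[swap] ->; rewrite ltnn.
Qed.

Lemma glued_shift_dim : has_krull_dim R n.
Proof.
split; last exact: glued_dim_le.
by have [[hC _] _ _] := long_chain; eexists; exact: hC.
Qed.

End Chains.

Theorem proposition4p1 (m n : nat) (hm : (1 < m)%N) (hmn : (m < n)%N) :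
  exists R : idomainType,
    [/\ local_ring R,
        ~ catenary R,
        has_krull_dim R n
      & exists (M : set R) (C : 'I_m.+1 -> set R),
          maximal_ideal M /\ saturated_chain_between [set 0] M C].
Proof.
have [T [tau [theta [tauK thetaK]]]] := exists_idomain_iso_poly.
have [R [i [i_inj iP]]] :=
  exists_glued_ring (eval_iter tau 0 n) (eval_iter tau 1 m).
exists R; split.
- exact: (glued_shift_local tauK thetaK hm hmn i_inj iP).
- exact: (glued_shift_noncatenary tauK thetaK hm hmn i_inj iP).
- exact: (glued_shift_dim tauK thetaK hm hmn i_inj iP).
exists (extension (eval_iter tau 0 n) (eval_iter tau 1 m) i
  (conductor (eval_iter tau 0 n) (eval_iter tau 1 m))).
eexists; split; first exact: (conductor_maximal i_inj iP).
exact: (short_chain tauK thetaK hm hmn i_inj iP).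
Qed.
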